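(* Let $k>2$ be a prime such that $2^k-1$ is prime. Let $n = 2^{\alpha-1}p$, where $\alpha>1$ is an integer and $p$ is an odd prime with $p<3\cdot 2^{\alpha-1}-1$. Then $n$ divides $\sigma_k(n)$ if and only if $n$ is an even perfect number and $n\neq 2^{k-1}(2^k-1)$.
   Context: For a positive integer $n$ and integer $k\ge 1$, $\sigma_k(n)=\sum_{d\mid n} d^k$, the sum over positive divisors $d$ of $n$. A positive integer $n$ is perfect if $\sigma_1(n)=2n$. *)

(* Defs.v *)
From mathcomp Require Import all_boot.

Set Implicit Arguments.
Unset Strict Implicit.
Unset Printing Implicit Defensive.

Definition sigma (k n : nat) : nat := \sum_(d <- divisors n) d ^ k.

Definition perfect (n : nat) : bool := (0 < n) && (sigma 1 n == 2 * n).

(* Main.v *)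
(** Since [sigma k (2^(alpha-1) * p) = S * (1 + p^k)] with
    [S = \sum_(i < alpha) (2^k)^i] odd and [1 + p^k] prime to [p], the
    divisibility splits into [2^(alpha-1) %| 1 + p^k] and [p %| S]. As [k] is
    odd, [1 + p^k] is [1 + p] times an odd number, so the bound on [p] leaves
    only [p = 2^(alpha-1) - 1] and [p = 2^alpha - 1]. In either case, if
    [p = 2^k - 1] then [S] is congruent to [alpha] modulo [p] and
    [0 < alpha < p], so [p] does not divide [S]. The first case forces
    [p %| 2^k - 1], hence is impossible; in the second, [p] divides
    [2^(k * alpha) - 1 = (2^k - 1) * S], hence divides [S] as soon as
    [p <> 2^k - 1]. *)
Require Import Defs.
From mathcomp Require Import all_boot zify.

(** The two lists collect the divisors prime to [p] and those divisible by [p]; they are disjoint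
    because [p] does not divide [n]. *)
Lemma perm_divisors_primeM p n : prime p -> 0 < n -> ~~ (p %| n) ->
  perm_eq (divisors (p * n)) (divisors n ++ [seq p * d | d <- divisors n]).
Proof.
move=> p_pr n_gt0 pNn; have p_gt0 := prime_gt0 p_pr.
apply: uniq_perm; first exact: divisors_uniq.
  rewrite cat_uniq divisors_uniq map_inj_uniq ?divisors_uniq ?andbT /=; last first.
    by move=> x y /eqP; rewrite eqn_pmul2l // => /eqP.
  apply/hasPn => _ /mapP[d _ ->]; rewrite /= -dvdn_divisors //.
  by apply: contra pNn; apply: dvdn_trans; apply: dvdn_mulr.
move=> d; rewrite mem_cat -!dvdn_divisors ?muln_gt0 ?p_gt0 //.
apply/idP/orP => [dpn|[dn|/mapP[e]]].
- have [/dvdnP[e de]|pNd] := boolP (p %| d); last first.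
    by left; rewrite -(@Gauss_dvdr _ p) // coprime_sym prime_coprime.
  right; apply/mapP; exists e; last by rewrite de mulnC.
  by move: dpn; rewrite de mulnC dvdn_pmul2l // -dvdn_divisors.
- exact: dvdn_mull.
- by rewrite -dvdn_divisors // => en ->; rewrite dvdn_pmul2l.
Qed.

Lemma sigma_primeM k p n : prime p -> 0 < n -> ~~ (p %| n) ->
  sigma k (p * n) = (1 + p ^ k) * sigma k n.
Proof.
move=> p_pr n_gt0 pNn; rewrite /sigma.
rewrite (perm_big _ (perm_divisors_primeM _ _ p_pr n_gt0 pNn)) /=.
rewrite big_cat big_map mulnDl mul1n big_distrr /=.
by congr (_ + _); apply: eq_bigr => d _; rewrite expnMn.
Qed.

Lemma sigma_pfactor k p m : prime p ->
  sigma k (p ^ m) = \sum_(i < m.+1) (p ^ k) ^ i.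
Proof.
move=> p_pr; have p_gt1 := prime_gt1 p_pr.
rewrite /sigma (perm_big [seq p ^ i | i <- index_iota 0 m.+1]); last first.
  apply: uniq_perm; first exact: divisors_uniq.
    by rewrite map_inj_uniq ?iota_uniq //; apply: expnI.
  move=> d; rewrite -dvdn_divisors ?expn_gt0 ?prime_gt0 //.
  apply/(dvdn_pfactor _ _ p_pr)/mapP => -[i im ->]; exists i => //.
    by rewrite mem_index_iota.
  by move: im; rewrite mem_index_iota.
rewrite big_map big_mkord.
by apply: eq_bigr => i _; rewrite -!expnM mulnC.
Qed.

Lemma odd_expS_factor p k : odd p -> odd k ->
  exists2 c, odd c & 1 + p ^ k = (1 + p) * c.
Proof.
move=> p_odd k_odd; set T := \sum_(i < k./2) (p ^ 2) ^ i.
(* This is [1 - p + p^2 - ... + p^(k-1)], with the terms after 1 paired to avoid subtraction; it is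
   odd since [p * p.-1] is even. *)
exists (1 + p * (p.-1 * T)).
  by rewrite oddD !oddM; move: T => T; case: p p_odd => //= p /negbTE->.
have kE : p ^ k = p * (p ^ 2) ^ k./2.
  by rewrite -expnM -expnS mul2n -{1}(odd_double_half k) k_odd.
have p_gt0 : 0 < p by exact: odd_gt0.
have := predn_exp (p ^ 2) k./2; rewrite -/T kE => eT.
have X_gt0 : 0 < (p ^ 2) ^ k./2 by rewrite !expn_gt0 p_gt0.
have -> : (p ^ 2) ^ k./2 = 1 + (p ^ 2).-1 * T by lia.
move: T {kE eT X_gt0}; case: p p_gt0 {p_odd} => // p _ T.
by rewrite -!mulnn /=; nia.
Qed.

Lemma modn_geometric x d a : x = 1 %[mod d] -> \sum_(i < a) x ^ i = a %[mod d].
Proof.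
move=> x1; elim: a => [|a IH]; first by rewrite big_ord0.
by rewrite big_ord_recr /= -modnDm IH -modnXm x1 modnXm exp1n modnDm addn1.
Qed.

(** Only the term [i = 0] is odd. *)
Lemma odd_geometric x a : ~~ odd x -> 0 < a -> odd (\sum_(i < a) x ^ i).
Proof.
move=> xN; case: a => // a _; rewrite big_ord_recl oddD expn0 /=.
apply: (big_ind (fun y => ~~ odd y)) => // [y z|i _].
  by rewrite oddD => /negbTE-> /negbTE->.
by rewrite oddX (negbTE xN).
Qed.

Lemma ndvdn_geometric_Mersenne k a : 0 < a < 2 ^ k - 1 ->
  ~~ (2 ^ k - 1 %| \sum_(i < a) (2 ^ k) ^ i).
Proof.
case/andP=> a_gt0 a_lt; have x1 : 2 ^ k = 1 %[mod 2 ^ k - 1].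
  by rewrite -[X in X %% _](@subnKC 1) ?expn_gt0 // modnDr.
by rewrite /dvdn (modn_geometric _ _ _ x1) modn_small // lt0n_neq0.
Qed.

(** Gives [alpha < 2 ^ k - 1] for both [alpha = k] and [alpha = k.+1], the two values that occur
    when [p = 2 ^ k - 1]. *)
Lemma ltn_Mersenne k : 2 < k -> k.+1 < 2 ^ k - 1.
Proof.
elim: k => // k IH; rewrite ltnS leq_eqVlt => /predU1P[<- //|/IH].
by rewrite expnS; lia.
Qed.

Lemma Mersenne_inj k l : 2 ^ k - 1 = 2 ^ l - 1 -> k = l.
Proof.
move=> e; have := expn_gt0 2 k; have := expn_gt0 2 l => /= l0 k0.
by apply: (@expnI 2) => //; lia.
Qed.

(** The divisor sum is [(1 + p) * (2 ^ a - 1)], which exceeds [2 ^ a * p] by [2 ^ a - 1 - p], a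
    difference taken in the integers. *)
Lemma even_perfect_pow2M a p : 0 < a -> prime p -> odd p ->
  perfect (2 ^ (a - 1) * p) = (p == 2 ^ a - 1).
Proof.
case: a => // a _ p_pr p_odd; rewrite subn1 /=.
have pN2 : ~~ (p %| 2 ^ a).
  rewrite -prime_coprime // coprime_sym coprimeXl // coprime2n //.
rewrite /perfect muln_gt0 expn_gt0 (prime_gt0 p_pr) /=.
rewrite mulnC sigma_primeM ?expn_gt0 // sigma_pfactor // !expn1.
have := predn_exp 2 a.+1; rewrite /= mul1n => <-.
have := expn_gt0 2 a; rewrite expnS /= => x_gt0.
by apply/eqP/eqP; nia.
Qed.

Theorem theorem1p3 (k n alpha p : nat)
    (hk2 : 2 < k) (hk : prime k) (hMk : prime (2 ^ k - 1))
    (halpha : 1 < alpha) (hp : prime p) (hpodd : odd p)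
    (hpbound : p < 3 * 2 ^ (alpha - 1) - 1)
    (hn : n = 2 ^ (alpha - 1) * p) :
  n %| sigma k n <->
  (~~ odd n /\ perfect n) /\ n <> 2 ^ (k - 1) * (2 ^ k - 1).
Proof.
have k_odd : odd k by case: (even_prime hk) hk2 => // ->.
have a_gt0 : 0 < alpha by lia.
have co2p m : coprime (2 ^ m) p by rewrite coprimeXl // coprime2n.
have pN2 : ~~ (p %| 2 ^ (alpha - 1)) by rewrite -prime_coprime // coprime_sym.
have n_even : ~~ odd n by rewrite hn oddM oddX subn_eq0 leqNgt halpha.
pose S := \sum_(i < alpha) (2 ^ k) ^ i.
have sigmaE : sigma k n = (1 + p ^ k) * S.
  rewrite hn mulnC sigma_primeM ?expn_gt0 // sigma_pfactor //.
  by rewrite subn1 prednK.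
have S_odd : odd S by apply: odd_geometric; rewrite // oddX gtn_eqF // prime_gt0.
have SE : 2 ^ (k * alpha) - 1 = (2 ^ k - 1) * S.
  by rewrite expnM !subn1 predn_exp.
have dvdE : (n %| sigma k n) = (2 ^ (alpha - 1) %| 1 + p) && (p %| S).
  rewrite hn Gauss_dvd // -hn sigmaE; congr andb.
    have [c c_odd ->] := odd_expS_factor _ _ hpodd k_odd.
    by rewrite -mulnA Gauss_dvdl // coprimeXl // coprime2n oddM c_odd.
  rewrite Gauss_dvdr // prime_coprime // dvdn_addl ?dvdn_exp //; last lia.
  by rewrite dvdn1 neq_ltn prime_gt1 // orbT.
have Mk_big := ltn_Mersenne _ hk2.
have twoE : 2 ^ alpha = 2 * 2 ^ (alpha - 1) by rewrite -expnS subn1 prednK.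
have eqnE : p = 2 ^ alpha - 1 ->
    (n = 2 ^ (k - 1) * (2 ^ k - 1)) <-> alpha = k.
  move=> pE; split=> [|ak]; last by rewrite hn -ak -pE.
  (* The odd prime [p] must divide the odd part [2 ^ k - 1], itself prime, so the two coincide. *)
  have pM : p %| n by rewrite hn dvdn_mull.
  move=> nE; move: pM; rewrite nE Gauss_dvdr 1?coprime_sym //.
  by rewrite dvdn_prime2 // pE => /eqP/Mersenne_inj.
rewrite dvdE hn even_perfect_pow2M // -hn; split.
- case/andP=> /dvdnP[m pE] pS; have m_gt0 : 0 < m by case: m pE.
  have m_lt3 : m < 3.
    by rewrite -(@ltn_pmul2r (2 ^ (alpha - 1))) ?expn_gt0 // -pE -ltn_subRL.
  have [m1|m2] : m = 1 \/ m = 2.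
    by case: m m_gt0 m_lt3 {pE} => [|[|[|]]] //; [left|right].
    rewrite m1 mul1n in pE.
    have pE1 : p = 2 ^ (alpha - 1) - 1 by rewrite -pE addKn.
    (* Modulo [p], [2 ^ (alpha - 1)] is 1, so [2 ^ (k * alpha)] is both [2 ^ k] and, as [p] divides
       [S], 1. *)
    have pMk : p %| 2 ^ k - 1.
      have : p %| 2 ^ (k * alpha) - 1 by rewrite SE dvdn_mull.
      have -> : 2 ^ (k * alpha) = 2 ^ k * (2 ^ (alpha - 1)) ^ k.
        rewrite -expnM -expnD -{1}(subnKC a_gt0).
        by rewrite mulnDr muln1 (mulnC k).
      rewrite -eqn_mod_dvd ?muln_gt0 ?expn_gt0 //.
      rewrite -pE -modnMmr -modnXm modnDr modnXm exp1n.
      by rewrite modnMmr muln1 eqn_mod_dvd ?expn_gt0.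
    have pMkE : p = 2 ^ k - 1 by apply/eqP; rewrite -dvdn_prime2.
    have ak : alpha - 1 = k by apply: Mersenne_inj; rewrite -pE1.
    have := ndvdn_geometric_Mersenne k alpha.
    rewrite -pMkE pS (_ : 0 < alpha < p) => [/(_ isT)//|].
    by rewrite a_gt0 pMkE -(subnKC a_gt0) ak.
  have pE2 : p = 2 ^ alpha - 1 by rewrite twoE -{1}m2 -pE addKn.
  split; first by rewrite pE2 eqxx.
  move/(eqnE pE2) => ak; have := ndvdn_geometric_Mersenne k alpha.
  have -> : 2 ^ k - 1 = p by rewrite -ak.
  rewrite pS; have : 0 < alpha < p by rewrite a_gt0 pE2 ak ltnW.
  by move=> -> /(_ isT).
- case=> -[_ /eqP pE] nN; apply/andP; split.
    by rewrite pE subnKC ?expn_gt0 // twoE dvdn_mull.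
  (* The factor [2 ^ k - 1] may be inserted: it is a prime other than [p], since equality would
     force [alpha = k], the excluded [n]. *)
  rewrite -(@Gauss_dvdr _ (2 ^ k - 1)).
    by rewrite -SE pE mulnC expnM !subn1 (predn_exp _ k) dvdn_mulr.
  rewrite prime_coprime // dvdn_prime2 // pE; apply/eqP => /Mersenne_inj ak.
  by apply: nN; apply/(eqnE pE).
Qed.
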